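(* Let $A$ be a finite non-empty alphabet, let $x\in A^\omega$ be a recurrent word, and let $N$ be a positive integer. Suppose there is an integer $k>0$ such that $\lambda_x(n)=n+k$ whenever $n\ge N$. Then $x\in\mathcal P$.
   Context: $A^\omega$ is the set of one-sided infinite words over $A$. $\lambda_x(n)$ denotes the number of distinct factors (contiguous blocks) of $x$ of length $n$. The word $x$ is recurrent if each of its factors occurs infinitely many times in $x$. $\mathrm{Fact}^+x$ is the set of non-empty finite factors of $x$. A factorization of $x$ is an expression $x=U_1U_2U_3\cdots$ with all $U_i$ non-empty finite words. $\mathcal P$ is the class of infinite words $x$ over finite alphabets for which there exist a finite set $C$ and a map (coloring) $c:\mathrm{Fact}^+x\to C$ such that for each factorization $x=U_1U_2U_3\cdots$ there exist $i,j\ge1$ with $c(U_i)\ne c(U_j)$. *)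

(* Defs.v *)
From mathcomp Require Import all_boot.
From mathcomp Require Import boolp classical_sets cardinality.

Set Implicit Arguments.
Unset Strict Implicit.
Unset Printing Implicit Defensive.

Local Open Scope classical_set_scope.

(* A one-sided infinite word over A is a function [nat -> A]; letters, and the
   words of a factorization, are indexed from 0. *)

Definition block (A : Type) (x : nat -> A) (i n : nat) : seq A :=
  [seq x k | k <- iota i n].

Definition occurs_at (A : Type) (x : nat -> A) (w : seq A) (i : nat) : Prop :=
  block x i (size w) = w.

Definition is_factor (A : Type) (x : nat -> A) (w : seq A) : Prop :=
  exists i, occurs_at x w i.

Definition complexity (A : finType) (x : nat -> A) (n : nat) : nat :=
  #|[set w : n.-tuple A | `[< is_factor x w >]]%SET|.

Definition recurrent (A : Type) (x : nat -> A) : Prop :=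
  forall w, is_factor x w -> infinite_set [set i | occurs_at x w i].

Definition fact_plus (A : eqType) (x : nat -> A) : set (seq A) :=
  [set w | w != [::] /\ is_factor x w].

(* As the U i are non-empty, x = U 0 U 1 U 2 ... holds if and only if every
   finite concatenation U 0 ... U (n-1) is a prefix of x. *)
Definition factorization (A : eqType) (x : nat -> A) (U : nat -> seq A) : Prop :=
  (forall i, U i != [::]) /\
  (forall n, occurs_at x (flatten (mkseq U n)) 0).

Lemma factorization_fact_plus (A : eqType) (x : nat -> A) (U : nat -> seq A) :
  factorization x U -> forall i, U i \in fact_plus x.
Proof.
move=> [U0 UP] i; apply/mem_set; split; first exact: U0.
exists (size (flatten (mkseq U i))).
have := UP i.+1; rewrite /occurs_at /block /mkseq -addn1 iotaD add0n map_cat.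
rewrite flatten_cat /= cats0 size_cat iotaD map_cat add0n => /eqP.
rewrite eqseq_cat; first by case/andP=> _ /eqP.
by rewrite size_map size_iota.
Qed.

Definition factorization_word (A : eqType) (x : nat -> A) (U : nat -> seq A)
    (xU : factorization x U) (i : nat) : fact_plus x :=
  exist _ (U i) (factorization_fact_plus xU i).

Definition class_P (A : finType) (x : nat -> A) : Prop :=
  exists (C : finType) (c : fact_plus x -> C),
    forall (U : nat -> seq A) (xU : factorization x U),
      exists i j, c (factorization_word xU i) <> c (factorization_word xU j).

(* Main.v *)
Require Import Defs.
From mathcomp Require Import all_boot.
From mathcomp Require Import boolp classical_sets.

(** Every infinite word x that is not purely periodic is in the class P.  Fix a
    total order on the alphabet, ordering infinite words lexicographically, and
    color a factor u by whether u is a prefix of x and, if so, by whether the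
    tail y in x = uy satisfies x < y or y < x (x = y would make x purely
    periodic).  In a monochromatic factorization x = U_0 U_1 ... all the U_i are
    prefixes of x, as U_0 is.  If x = U_i y_i with x < y_i for all i, then
    U_i x < x, so x > U_0 x > U_0 U_1 x > ..., a strictly decreasing sequence
    that converges to its first term x, which is absurd; dually if y_i < x.
    Finally, a purely periodic word has bounded complexity. *)

Set Implicit Arguments.
Unset Strict Implicit.
Unset Printing Implicit Defensive.

Section Lexicographic.
Variables (T : Type) (R : rel T).
Hypotheses (R_irr : irreflexive R) (R_trans : transitive R).

Definition lex_at (p : nat) (y z : nat -> T) : Prop :=
  (forall j, j < p -> y j = z j) /\ R (y p) (z p).

(** The explicit minimum ensures that, along a chain of comparisons, the first difference never
    moves right. *)
Lemma lex_at_trans p q y z t :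
  lex_at p y z -> lex_at q z t -> lex_at (minn p q) y t.
Proof.
move=> [yz Ryz] [zt Rzt]; split=> [j|].
  by rewrite leq_min => /andP[jp jq]; rewrite yz // zt.
case: (ltngtP p q) => [pq|qp|pq]; first by rewrite -zt.
  by rewrite yz.
by rewrite -pq in Rzt; exact: R_trans Ryz Rzt.
Qed.

(* The word [u x], where [u] is the prefix of length [s] of [x]. *)
Definition prefix_cat (x : nat -> T) (s j : nat) : T :=
  if j < s then x j else x (j - s).

(** Here [s] lists the cut points of a factorization. The words [prefix_cat x (s n)] descend from
    [x], so for [n > 0] they differ from it at a bounded position; yet they share with [x] a prefix
    of length [s n], which is unbounded. *)
Lemma no_lex_increasing_tails (x : nat -> T) (s : nat -> nat) :
    s 0 = 0 -> (forall n, s n < s n.+1) ->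
    (forall n j, j < s n.+1 - s n -> x (s n + j) = x j) ->
    (forall n, exists p, lex_at p x (fun j => x (s n.+1 - s n + j))) ->
  False.
Proof.
move=> s0 s_incr x_pref x_lt.
have step n : exists p, lex_at p (prefix_cat x (s n.+1)) (prefix_cat x (s n)).
  have [p [eq_p R_p]] := x_lt n; have sn := ltnW (s_incr n).
  have prefE j : prefix_cat x (s n) (s n.+1 + j) = x (s n.+1 - s n + j).
    by rewrite /prefix_cat ltnNge (leq_trans sn (leq_addr _ _)) /= addnBAC.
  have prefSE j : prefix_cat x (s n.+1) (s n.+1 + j) = x j.
    by rewrite /prefix_cat ltnNge leq_addr addKn.
  (* Both words start with the first [s n.+1] letters of [x]; from there on one reads [x] and the
     other the tail compared in [x_lt]. *)
  exists (s n.+1 + p); split=> [j jp|]; last by rewrite prefE prefSE.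
  have [js|sj] := ltnP j (s n.+1); last first.
    by rewrite -(subnKC sj) prefE prefSE; apply: eq_p; rewrite ltn_subLR.
  rewrite /prefix_cat js; case: ltnP => // sj.
  by rewrite -[in LHS](subnKC sj) x_pref // ltn_sub2r // s_incr.
have [p lt_p] := step 0.
have below n : exists2 q, q <= p &
    lex_at q (prefix_cat x (s n.+1)) (prefix_cat x (s 0)).
  elim: n => [|n [q qp lt_q]]; first by exists p.
  have [r lt_r] := step n.+1; exists (minn r q); first by rewrite geq_min qp orbT.
  exact: lex_at_trans lt_r lt_q.
have s_ge n : n <= s n by elim: n => // n IHn; exact: leq_ltn_trans IHn (s_incr n).
(* Since [q <= p < s p.+1], both words have the letter [x q] at position [q]. *)
have [q qp [_]] := below p; rewrite /prefix_cat s0 /= subn0.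
by rewrite (leq_ltn_trans qp (s_ge p.+1)) R_irr.
Qed.

End Lexicographic.

Lemma nth_block (A : Type) (a : A) (x : nat -> A) i n j :
  j < n -> nth a (block x i n) j = x (i + j).
Proof. by move=> jn; rewrite (nth_map 0) ?size_iota // nth_iota. Qed.

Lemma size_block (A : Type) (x : nat -> A) i n : size (block x i n) = n.
Proof. by rewrite size_map size_iota. Qed.

Lemma flatten_mkseqS (A : Type) (U : nat -> seq A) n :
  flatten (mkseq U n.+1) = flatten (mkseq U n) ++ U n.
Proof. by rewrite mkseqS flatten_rcons. Qed.

Lemma factorization_occurs_at (A : eqType) (x : nat -> A) U n :
  factorization x U -> occurs_at x (U n) (size (flatten (mkseq U n))).
Proof.
case=> _ /(_ n.+1); rewrite /occurs_at flatten_mkseqS size_cat /block iotaD.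
rewrite map_cat add0n => /eqP.
by rewrite eqseq_cat ?size_map ?size_iota // => /andP[_ /eqP].
Qed.

Lemma aperiodic_class_P (A : finType) (x : nat -> A) :
    (forall d, 0 < d -> exists j, x (d + j) <> x j) -> class_P x.
Proof.
move=> aper; pose rk (a : A) : nat := enum_rank a.
pose lt := relpre rk ltn; pose gt := relpre rk (fun m n => n < m).
pose up d := exists p, lex_at lt p x (fun j => x (d + j)).
have lt_gt d : 0 < d -> ~ up d -> exists p, lex_at gt p x (fun j => x (d + j)).
  move=> d_gt0 not_up.
  have ex : exists j, x (d + j) != x j by have [j /eqP] := aper d d_gt0; exists j.
  case: (ex_minnP ex) => p neq_p min_p.
  (* At the first difference [p], totality of the order on ranks leaves only [gt]. *)
  have eq_p j : j < p -> x j = x (d + j).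
    move=> jp; apply/eqP; rewrite eq_sym; apply: contraTT jp => neq_j.
    by rewrite -leqNgt min_p.
  exists p; split=> //=; rewrite /gt /= ltn_neqAle.
  rewrite (inj_eq val_inj) (inj_eq enum_rank_inj) neq_p /= leqNgt.
  by apply/negP => lt_p; apply: not_up; exists p.
pose c (w : fact_plus x) : option bool :=
  if `[< occurs_at x (val w) 0 >] then Some `[< up (size (val w)) >] else None.
exists (option bool), c => U xU; apply: contrapT => no_ij.
have mono n : c (factorization_word xU n) = c (factorization_word xU 0).
  by apply: contrapT => neq; apply: no_ij; exists n, 0.
pose s n := size (flatten (mkseq U n)).
have sB n : s n.+1 - s n = size (U n).
  by rewrite /s flatten_mkseqS size_cat addKn.
have U_gt0 n : 0 < size (U n) by rewrite lt0n size_eq0 (proj1 xU).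
have s_incr n : s n < s n.+1 by rewrite -subn_gt0 sB.
(* This rules out [None] as the common color. *)
have occ0 : occurs_at x (U 0) 0 by have := factorization_occurs_at 0 xU.
have c0 : c (factorization_word xU 0) = Some `[< up (size (U 0)) >].
  by rewrite /c /= asboolT.
have occ n : occurs_at x (U n) 0.
  by have := mono n; rewrite c0 /c /=; case: asboolP.
have up_const n : `[< up (size (U n)) >] = `[< up (size (U 0)) >].
  by have := mono n; rewrite c0 /c /= asboolT //; case.
have pref n j : j < s n.+1 - s n -> x (s n + j) = x j.
  rewrite sB => jU; have := factorization_occurs_at n xU.
  rewrite /occurs_at -[in RHS](occ n) => /(congr1 (nth (x 0) ^~ j)).
  by rewrite !nth_block.
have lt_irr : irreflexive lt by move=> a; exact: ltnn.
have lt_trans : transitive lt by move=> a b d; exact: ltn_trans.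
have gt_irr : irreflexive gt by move=> a; exact: ltnn.
have gt_trans : transitive gt by move=> a b d ab bd; exact: ltn_trans bd ab.
have [up0|down0] := asboolP (up (size (U 0))).
  apply: (no_lex_increasing_tails lt_irr lt_trans _ s_incr pref) => // n.
  by rewrite sB; apply/asboolP; rewrite -/(up _) up_const asboolT.
apply: (no_lex_increasing_tails gt_irr gt_trans _ s_incr pref) => // n.
by rewrite sB; apply: lt_gt => //; apply/asboolPn; rewrite up_const asboolF.
Qed.

(** Reducing the starting position modulo [d], every factor occurs at one of the positions below
    [d]. *)
Lemma periodic_complexity (A : finType) (x : nat -> A) d n :
  0 < d -> (forall j, x (d + j) = x j) -> complexity x n <= d.
Proof.
move=> d_gt0 per.
have x_mod i j : x (i + j) = x (i %% d + j).
  rewrite [in LHS](divn_eq i d) -addnA.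
  by elim: (i %/ d) => // q IHq; rewrite mulSn -addnA per.
have size_b (i : 'I_d) : size (block x i n) == n by rewrite size_block.
rewrite -[d in _ <= d]card_ord -cardsT /complexity.
apply: leq_trans (leq_imset_card (fun i => Tuple (size_b i)) _).
apply/subset_leq_card/fintype.subsetP => w; rewrite inE => /asboolP[i].
rewrite /occurs_at size_tuple => w_occ.
apply/imsetP; exists (Ordinal (ltn_pmod i d_gt0)) => //.
apply: val_inj; rewrite /= -w_occ.
apply: (@eq_from_nth _ (x 0)); rewrite !size_block // => j jn.
by rewrite !nth_block.
Qed.

Theorem corollary6p12 (A : finType) (hA : 0 < #|A|) (x : nat -> A)
    (hx : recurrent x) (N : nat) (hN : 0 < N)
    (hk : exists k : nat,
        0 < k /\ forall n : nat, N <= n -> complexity x n = n + k) :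
  class_P x.
Proof.
have [k [_ x_cplx]] := hk.
apply: aperiodic_class_P => d d_gt0; apply: contrapT => per_d.
have per j : x (d + j) = x j.
  by apply: contrapT => neq_j; apply: per_d; exists j.
(* At length [N + d] the bound would read [N + d + k <= d], against [0 < N]. *)
have := periodic_complexity (N + d) d_gt0 per.
rewrite x_cplx ?leq_addr // -addnA addnCA.
by rewrite -leq_subRL // subnn leqNgt addn_gt0 hN.
Qed.
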